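(* Let $\mu$ be a singular cardinal with cofinality $\kappa$. Suppose that (i) $2^\kappa < \mu^{+\kappa^+}$, (ii) $\mathrm{cf}([\alpha]^\kappa, \subseteq) < \mu$ for all $\alpha < \mu$, and (iii) $2^\kappa < 2^\nu$ for some $\nu < \mu$. Then $\mathfrak{d}_\mu \geq 2^{<\mu}$.
   Context: Work in ZFC. $\kappa^\mu$ (as a set) denotes the set of functions from $\mu$ to $\kappa$. For $f,g\in\kappa^\mu$, $f$ dominates $g$ if $\{\alpha<\mu \mid f(\alpha)\le g(\alpha)\}$ has size less than $\mu$. A family $\mathcal{D}\subseteq\kappa^\mu$ is a dominating family if for every $f\in\kappa^\mu$ there is $g\in\mathcal{D}$ which dominates $f$. $\mathfrak{d}_\mu$ is the least cardinality of a dominating family $\mathcal{D}\subseteq\kappa^\mu$. $[\alpha]^\kappa$ is the set of subsets of $\alpha$ of cardinality $\kappa$, and $\mathrm{cf}([\alpha]^\kappa,\subseteq)$ is the least cardinality of a set $C\subseteq[\alpha]^\kappa$ that is cofinal, i.e. every $x\in[\alpha]^\kappa$ is included in some $y\in C$. $\mu^{+\kappa^+}$ is the $\kappa^+$-th iterated cardinal successor of $\mu$ (if $\mu=\aleph_\xi$, then $\mu^{+\kappa^+}=\aleph_{\xi+\kappa^+}$). $2^{<\mu}=\sup\{2^\nu\mid \nu<\mu \text{ a cardinal}\}$. *)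

(* Defs.v *)
From HB Require Import structures.
From mathcomp Require Import all_boot all_order.
From mathcomp Require Import wochoice boolp classical_sets cardinality.

Set Implicit Arguments.
Unset Strict Implicit.
Unset Printing Implicit Defensive.

Import Order.TTheory.
Local Open Scope order_scope.
Local Open Scope classical_set_scope.
Local Open Scope quotient_scope.

(* Set theory is rendered by a universe of types: sets are the types in the
   universe of [wo_sort], and ordinals are the well-ordered types of that
   universe up to isomorphism.  As a consequence, [wo_sort] must keep a universe
   of its own, strictly below that of MathComp's structures and of [set]; this
   is why small power sets are written [T -> Prop] and not [set T]. *)

Fact wo_display : Order.disp_t. Proof. exact: (Order.Disp tt tt). Qed.

Record woType := WoType {
  wo_sort :> Type;
  wo_le : rel wo_sort;
  wo_leP : well_order wo_le }.

HB.instance Definition _ := gen_eqMixin woType.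
HB.instance Definition _ := gen_choiceMixin woType.
HB.instance Definition _ (A : woType) := gen_eqMixin (wo_sort A).
HB.instance Definition _ (A : woType) := gen_choiceMixin (wo_sort A).

Section WoTypeOrder.
Variable A : woType.
Local Notation le := (@wo_le A).

Lemma wo_le_total : total le.
Proof.
move=> x y; have [|z [[+ zmin] _]] := @wo_leP A (pred2 x y).
  by exists x; rewrite inE eqxx.
have := zmin y; have := zmin x.
rewrite !inE !eqxx orbT => /(_ isT) zx /(_ isT) zy.
by move=> /pred2P[] <-; rewrite ?zx ?zy ?orbT.
Qed.

Lemma wo_le_refl : reflexive le.
Proof. by move=> x; have := wo_le_total x x; rewrite orbb. Qed.

Lemma wo_le_anti : antisymmetric le.
Proof.
move=> x y /andP[xy yx]; have [|z [_ zuniq]] := @wo_leP A (pred2 x y).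
  by exists x; rewrite inE eqxx.
rewrite -(zuniq x) ?(zuniq y) //; split; rewrite ?inE ?eqxx ?orbT //.
  by move=> t /pred2P[] ->; rewrite ?wo_le_refl.
by move=> t /pred2P[] ->; rewrite ?wo_le_refl.
Qed.

Lemma wo_le_trans : transitive le.
Proof.
move=> y x z xy yz; have [|t [[+ tmin] _]] := @wo_leP A (pred3 x y z).
  by exists x; rewrite inE eqxx.
have := tmin z; have := tmin y; have := tmin x.
rewrite !inE !eqxx !orbT => /(_ isT) tx /(_ isT) ty /(_ isT) tz.
move=> /or3P[] /eqP E; rewrite E in tx ty tz => //.
- by have -> : x = y by apply: wo_le_anti; rewrite xy tx.
- by have <- : y = z by apply: wo_le_anti; rewrite yz ty.
Qed.

End WoTypeOrder.

HB.instance Definition _ (A : woType) :=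
  Order.Le_isPOrder.Build wo_display (wo_sort A)
    (@wo_le_refl A) (@wo_le_anti A) (@wo_le_trans A).
HB.instance Definition _ (A : woType) :=
  Order.POrder_isTotal.Build wo_display (wo_sort A) (@wo_le_total A).

Lemma wo_min (A : woType) (P : A -> Prop) :
  (exists x, P x) -> exists2 x, P x & forall y, P y -> x <= y.
Proof.
move=> [x Px]; have [|z [[zP zmin] _]] := @wo_leP A (fun x => `[< P x >]).
  by exists x; apply/asboolP.
by exists z; [exact/asboolP|move=> y Py; apply: zmin; apply/asboolP].
Qed.

Lemma wo_ind (A : woType) (P : A -> Prop) :
  (forall x, (forall y, y < x -> P y) -> P x) -> forall x, P x.
Proof.
move=> IH x; apply: contrapT => nPx.
have [z nPz zmin] := @wo_min A (fun z => ~ P z) (ex_intro _ x nPx).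
apply/nPz/IH => y yz; apply: contrapT => /zmin; by rewrite leNgt yz.
Qed.

Definition wo_iso (A B : woType) (f : A -> B) :=
  bijective f /\ {mono f : x y / x <= y}.

Definition initial_embedding (A B : woType) (f : A -> B) :=
  {mono f : x y / x <= y} /\ forall x y, y <= f x -> exists z, f z = y.

Lemma init_id (A : woType) : initial_embedding (@id A).
Proof. by split=> // x y _; exists y. Qed.

Lemma init_comp (A B C : woType) (f : A -> B) (g : B -> C) :
  initial_embedding f -> initial_embedding g -> initial_embedding (g \o f).
Proof.
move=> [fm fi] [gm gi]; split=> [x y|x y /= yx]; first by rewrite /= gm fm.
have [z zy] := gi _ _ yx; have /fi[t tz] : z <= f x by rewrite -gm zy.
by exists t; rewrite /= tz.
Qed.

Lemma init_inj (A B : woType) (f : A -> B) : initial_embedding f -> injective f.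
Proof. by move=> [fm _]; exact: inc_inj. Qed.

Lemma init_le (A B : woType) (f g : A -> B) :
  initial_embedding f -> initial_embedding g -> forall x, f x <= g x.
Proof.
move=> fI gI; apply: wo_ind => x IH; rewrite leNgt; apply/negP => gf.
have [z zg] := fI.2 _ _ (ltW gf).
have zx : z < x by rewrite -(leW_mono fI.1) zg.
have := IH _ zx; rewrite zg leNgt => /negP; apply.
by rewrite (leW_mono gI.1).
Qed.

Lemma init_uniq (A B : woType) (f g : A -> B) :
  initial_embedding f -> initial_embedding g -> f =1 g.
Proof. by move=> fI gI x; apply/le_anti; rewrite !init_le. Qed.

Lemma init_iso (A B : woType) (f : A -> B) (g : B -> A) :
  initial_embedding f -> initial_embedding g -> wo_iso f.
Proof.
move=> fI gI; split; last exact: fI.1.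
exists g => x; first exact: (init_uniq (init_comp fI gI) (@init_id A)).
exact: (init_uniq (init_comp gI fI) (@init_id B)).
Qed.

Lemma iso_init (A B : woType) (f : A -> B) : wo_iso f -> initial_embedding f.
Proof. by move=> [[g fK gK] fm]; split=> // x y _; exists (g y); rewrite gK. Qed.

(* Same rank: the maximal isomorphism between initial segments. *)
Inductive wo_match (A B : woType) (x : A) (y : B) : Prop :=
  WoMatch of (forall x', x' < x -> exists2 y', y' < y & wo_match x' y')
           & (forall y', y' < y -> exists2 x', x' < x & wo_match x' y').

Lemma wo_matchC (A B : woType) (x : A) (y : B) : wo_match x y -> wo_match y x.
Proof.
move: x y; apply: wo_ind => x IH y [h1 h2]; split=> z.
  by move=> /h2[t tx m]; exists t => //; exact: IH.
by move=> zx; have [t ty m] := h1 _ zx; exists t => //; exact: IH.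
Qed.

Lemma wo_match_uniq (A B : woType) (x : A) (y y' : B) :
  wo_match x y -> wo_match x y' -> y = y'.
Proof.
move: x y y'; apply: wo_ind => x IH y y' m m'.
wlog yy' : y y' m m' / y < y'.
  by move=> W; case: (ltgtP y y') => // h; [apply: W|apply/esym/W].
case: m m' => h1 _ [_ h2]; have [z zx zy] := h2 _ yy'.
have [t ty zt] := h1 _ zx; by move: ty; rewrite (IH _ zx _ _ zt zy) ltxx.
Qed.

Lemma wo_match_lt (A B : woType) (x x' : A) (y y' : B) :
  wo_match x y -> wo_match x' y' -> x < x' -> y < y'.
Proof.
move=> m [h1 _] /h1[z zy' xz]; by rewrite (wo_match_uniq m xz).
Qed.

Lemma wo_match_init (A B : woType) :
  (forall x : A, exists y : B, wo_match x y) ->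
  exists f : A -> B, initial_embedding f.
Proof.
move=> /boolp.choice[f fP]; exists f; split=> [|x y].
  by apply: le_mono => x y; exact: wo_match_lt.
rewrite le_eqVlt => /predU1P[->|yfx]; first by exists x.
have [_ /(_ _ yfx)[z _ zy]] := fP x; exists z; exact: wo_match_uniq (fP z) zy.
Qed.

Lemma init_total (A B : woType) :
  (exists f : A -> B, initial_embedding f) \/
  (exists f : B -> A, initial_embedding f).
Proof.
have [h|/existsNP ex] := pselect (forall x : A, exists y : B, wo_match x y).
  by left; exact: wo_match_init.
have [h|/existsNP ey] := pselect (forall y : B, exists x : A, wo_match x y).
  right; apply: wo_match_init => y; have [x xy] := h y; exists x.
  exact: wo_matchC.
have [x0 x0N x0m] := wo_min ex; have [y0 ny0 y0m] := wo_min ey; exfalso.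
apply: (x0N); exists y0; split=> [x xx0|y yy0].
  have [y xy] : exists y : B, wo_match x y.
    by apply: contrapT => /x0m; rewrite leNgt xx0.
  exists y => //; rewrite ltNge; apply/negP.
  rewrite le_eqVlt => /predU1P[E|y0y]; first by apply: ny0; exists x; rewrite E.
  by have [_ /(_ _ y0y)[z _ zy0]] := xy; apply: ny0; exists z.
have [x xy] : exists x : A, wo_match x y.
  by apply: contrapT => /y0m; rewrite leNgt yy0.
exists x => //; rewrite ltNge; apply/negP.
rewrite le_eqVlt => /predU1P[E|x0x]; first by apply: x0N; exists y; rewrite E.
by have [/(_ _ x0x)[z _ zy0] _] := xy; apply: x0N; exists z.
Qed.

Definition wo_isob (A B : woType) : bool := `[< exists f : A -> B, wo_iso f >].

Lemma wo_isob_refl : reflexive wo_isob.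
Proof.
by move=> A; apply/asboolP; exists id; split=> //; exists id.
Qed.

Lemma wo_isob_sym : symmetric wo_isob.
Proof.
suff h A B : wo_isob A B -> wo_isob B A by move=> A B; apply/idP/idP; exact: h.
move=> /asboolP[f [[g fK gK] fm]]; apply/asboolP; exists g; split.
  by exists f.
by move=> x y; rewrite -fm !gK.
Qed.

Lemma wo_isob_trans : transitive wo_isob.
Proof.
move=> B A C /asboolP[f [fb fm]] /asboolP[g [gb gm]]; apply/asboolP.
exists (g \o f); split; first exact: bij_comp.
by move=> x y; rewrite /= gm fm.
Qed.

Canonical wo_isob_equiv := EquivRel wo_isob wo_isob_refl wo_isob_sym wo_isob_trans.

Definition ord := {eq_quot wo_isob}.
HB.instance Definition _ := Choice.on ord.
HB.instance Definition _ := EqQuotient.on ord.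

Implicit Types a b c mu kappa alpha nu xi : ord.

(* An ordinal is used as the set of the smaller ordinals, through a well-ordered
   type of its isomorphism class; it may thus be used as a type itself. *)
Definition ord_sort a : Type := wo_sort (repr a).
Coercion ord_sort : ord >-> Sortclass.
HB.instance Definition _ a := Order.Total.on (ord_sort a).

Definition ord_le a b : bool := `[< exists f : a -> b, initial_embedding f >].

Lemma ord_le_refl : reflexive ord_le.
Proof. by move=> a; apply/asboolP; exists id; exact: init_id. Qed.

Lemma ord_le_trans : transitive ord_le.
Proof.
move=> b a c /asboolP[f fI] /asboolP[g gI]; apply/asboolP.
by exists (g \o f); exact: init_comp.
Qed.

Lemma ord_le_anti : antisymmetric ord_le.
Proof.
move=> a b /andP[/asboolP[f fI] /asboolP[g gI]].
rewrite -[a]reprK -[b]reprK; apply/eqmodP/asboolP.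
by exists f; exact: init_iso gI.
Qed.

Lemma ord_le_total : total ord_le.
Proof.
by move=> a b; apply/orP; case: (init_total (repr a) (repr b)) => h;
  [left|right]; exact/asboolP.
Qed.

HB.instance Definition _ :=
  Order.Le_isPOrder.Build wo_display ord
    ord_le_refl ord_le_anti ord_le_trans.
HB.instance Definition _ :=
  Order.POrder_isTotal.Build wo_display ord ord_le_total.

Lemma ord_ltP a b : a < b ->
  exists f : a -> b, exists2 y : b, initial_embedding f &
    forall z, z < y <-> exists x, f x = z.
Proof.
rewrite lt_neqAle => /andP[neq /asboolP[f fI]]; exists f.
have [h|/existsNP h] := pselect (forall y : b, exists x, f x = y).
  case/negP: neq; rewrite -[a]reprK -[b]reprK; apply/eqP/eqmodP/asboolP.
  exists f; split; last exact: fI.1.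
  by have [g gP] := boolp.choice h; exists g => // x; apply: (init_inj fI).
have [y ny ymin] := wo_min h; exists y => // z; split=> [zy|[x <-]].
  by apply: contrapT => /ymin; rewrite leNgt zy.
by rewrite ltNge; apply/negP => /fI.2.
Qed.

Lemma ord_lt_wf : well_founded (fun a b => a < b).
Proof.
move=> a; constructor => b /ord_ltP[f [y fI fy]].
move: y b f fI fy; apply: wo_ind => y IH b f fI fy; constructor => c /ord_ltP[g [z gI gz]].
apply: (IH (f z) _ c (f \o g)); first by apply/fy; exists z.
  exact: init_comp.
move=> t; split=> [tfz|[x <-] /=].
  have [u ut] := fI.2 _ _ (ltW tfz).
  have /gz[x xu] : u < z by rewrite -(leW_mono fI.1) ut.
  by exists x; rewrite /= xu.
by rewrite (leW_mono fI.1); apply/gz; exists x.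
Qed.

Lemma void_wo : well_order (fun _ _ : void => true).
Proof. by move=> A [[]]. Qed.

Definition ord_zero : ord := \pi_ord (WoType void_wo).

(* The default value for empty P is irrelevant: below, P is inhabited because
   the types involved live in the universe of [wo_sort], so that they can be
   well-ordered, and families of ordinals indexed by them are bounded. *)
Definition ord_least (P : set ord) : ord :=
  xget ord_zero [set a | P a /\ forall b, P b -> a <= b].

Definition ord_sup (P : set ord) : ord :=
  ord_least [set b | forall a, P a -> a <= b].

Definition ord_card (T : Type) (A : set T) : ord :=
  ord_least [set a | (A #= [set: a])%card].

Definition is_cardinal a := ord_card [set: a] = a.

Definition card_succ a : ord := ord_least [set b | is_cardinal b /\ a < b].

(* [card_succ_iter mu xi] is mu^{+xi}, by recursion on xi: the supremum of mu
   and of all successors (mu^{+eta})^+ for eta < xi. *)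
Definition card_succ_iter mu : ord -> ord :=
  Fix ord_lt_wf (fun _ => ord) (fun xi rec =>
    ord_sup (mu |` [set b | exists eta (h : eta < xi), b = card_succ (rec eta h)])).

Definition pow2 kappa : ord := ord_card [set: kappa -> bool].

Definition pow2_lt mu : ord :=
  ord_sup [set pow2 nu | nu in [set nu | is_cardinal nu /\ nu < mu]].

Definition cofinality mu : ord :=
  ord_least [set ord_card C | C in
    [set C : set mu | forall x, exists2 y, C y & x <= y]].

Definition singular_cardinal mu :=
  [/\ is_cardinal mu, infinite_set [set: mu] & cofinality mu < mu].

Definition subsets_of_card alpha kappa : set (alpha -> Prop) :=
  [set x | ord_card x = kappa].

Definition cf_subsets alpha kappa : ord :=
  ord_least [set ord_card C | C in
    [set C : set (alpha -> Prop) | C `<=` @subsets_of_card alpha kappa /\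
      forall x, subsets_of_card kappa x -> exists2 y, C y & x `<=` y]].

Definition dominates mu kappa (f g : mu -> kappa) :=
  ord_card [set i | f i <= g i] < mu.

Definition dominating_family mu kappa (D : set (mu -> kappa)) :=
  forall f, exists2 g, D g & dominates g f.

Definition dominating_number mu kappa : ord :=
  ord_least [set ord_card D | D in @dominating_family mu kappa].

(* Main.v *)
Require Import Defs.
From HB Require Import structures.
From mathcomp Require Import all_boot all_order.
From mathcomp Require Import wochoice boolp classical_sets functions cardinality.

Set Implicit Arguments.
Unset Strict Implicit.
Unset Printing Implicit Defensive.

Import Order.TTheory.
Local Open Scope order_scope.
Local Open Scope classical_set_scope.
Local Open Scope card_scope.
Local Open Scope quotient_scope.

(** Suppose that D is a dominating family with |D| < 2^nu for some nu < mu;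
    enlarging 2^nu, one may assume that 2^kappa < 2^nu too. It is enough to
    find more than tau := max(|D|, 2^kappa) functions f_X : mu -> kappa,
    indexed by subsets X of nu, such that any kappa of them are simultaneously
    pairwise distinct at mu many points ([unbounded_family]). Indeed some g in
    D dominates more than tau of them, and since there are only kappa bounds
    below mu to choose from, kappa of these have exceptional sets of size
    bounded by a common cardinal below mu. Outside the union of the
    exceptional sets, which has size less than mu, there is a point m where
    the kappa values f_X(m) are distinct, yet all of them are below g(m) <
    kappa.

    As cf([nu]^kappa) < mu, there is a family C of fewer than mu subsets of
    nu, of size at most kappa, that covers all subsets of size kappa. A subset
    X is represented by its traces (Y, X :&: Y), Y in C. Call X caught by a
    set S of traces if the Y whose trace (Y, X :&: Y) is in S still cover
    every subset of nu of size kappa. If B is a set of fewer than mu traces,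
    then the sets caught by B have the functions that are wanted. For each Y0
    in C, choose a trace t(X, Y0) of X that lies in B and is taken on some Y
    containing Y0. For kappa many different X, choose Y0 so that it separates
    them: then their t(X, Y0) differ. As cf([|B|]^kappa) < mu, they lie in a
    member Z of a family, fixed in advance, of fewer than mu subsets of B of
    size at most kappa; let f_X be the composite of t(-, Y0) with an injection
    of Z into kappa, at mu many points that code (Y0, Z).

    It remains to find B, of size less than mu, that catches more than tau
    sets. All the traces catch all the subsets of nu, and there are at most
    max(|C|, 2^kappa) of them. If this is at least mu, then it is 2^kappa,
    hence at most some mu^{+xi} with xi < kappa^+, and an induction on xi
    decreases the size to less than mu ([descent]). It relies on two facts.
    First, if S is the union of kappa pieces, then a set caught by S is caught
    by one of the pieces ([covering_split]); since |xi| <= kappa, this deals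
    with limit xi, and with mu itself, whose cofinality is kappa. Second, only
    |C| < mu traces in S are needed to catch a given X; so if |S| is a
    successor b^+ with mu <= b, these lie in a proper initial segment of S. In
    both cases there are at most tau pieces, so that one of them catches more
    than tau sets. *)

(** * Cardinal comparisons by relations *)

(** An injective map into [B], given as a relation: contrary to a function
    from [T] to [U], such a relation may exist even if [U] is empty. *)
Lemma card_le_rel T U (A : set T) (B : set U) (R : T -> U -> Prop) :
  (forall x, A x -> exists2 y, B y & R x y) ->
  (forall x x' y, A x -> A x' -> R x y -> R x' y -> x = x') ->
  A #<= B.
Proof.
move=> Rtot Rinj.
have /boolp.choice[f fP] (x : A) : exists y : B, R (val x) (val y).
  have [y By Rxy] := Rtot _ (set_mem (valP x)).
  by exists (SigSub (mem_set By)).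
apply/card_leP/injfunPex; exists f => // x x' _ _ ff.
apply: val_inj; apply: (Rinj _ _ (val (f x))); try exact: set_mem (valP _).
  exact: fP.
by rewrite ff; exact: fP.
Qed.

Lemma card_le_inj T U (A : set T) (B : set U) (f : T -> U) :
  (forall x, A x -> B (f x)) ->
  (forall x x', A x -> A x' -> f x = f x' -> x = x') ->
  A #<= B.
Proof.
move=> fAB fI; apply: (@card_le_rel _ _ _ _ (fun x y => f x = y)).
  by move=> x Ax; exists (f x) => //; exact: fAB.
by move=> x x' y Ax Ax' <- /esym; exact: fI.
Qed.

Lemma card_le_exrel T U (A : set T) (B : set U) : A #<= B ->
  exists R : T -> U -> Prop,
  (forall x, A x -> exists2 y, B y & R x y) /\
  (forall x x' y, R x y -> R x' y -> x = x').
Proof.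
move=> /card_leP[f]; exists (fun x y => 
  exists (Ax : x \in A) (By : y \in B), f (SigSub Ax) = SigSub By).
split=> [x /mem_set Ax|x x' y].
  exists (val (f (SigSub Ax))); first exact: set_mem (valP _).
  by exists Ax, (valP _); apply: val_inj.
move=> [Ax [By fx]] [Ax' [By' fx']].
have ff : f (SigSub Ax) = f (SigSub Ax') by rewrite fx fx'; exact: val_inj.
by have /(congr1 val) := 'inj_f (in_setT _) (in_setT _) ff.
Qed.

Lemma card_le_fun T U (A : set T) (B : set U) (u : U) : A #<= B -> exists f : T -> U,
  (forall x, A x -> B (f x)) /\
  (forall x x', A x -> A x' -> f x = f x' -> x = x').
Proof.
move=> /card_le_exrel[R [Rtot Rinj]].
have /boolp.choice[f fP] x : exists y, A x -> B y /\ R x y.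
  have [/Rtot[y By Rxy]|nAx] := pselect (A x); last by exists u.
  by exists y.
exists f; split=> [x /fP[]//|x x' /fP[_ xf] /fP[_ xf'] ff].
by apply: Rinj xf _; rewrite ff.
Qed.

(** * Least ordinals, cardinals and initial segments *)

Lemma ord_least_spec (P : set ord) : (exists a, P a) ->
  P (ord_least P) /\ forall b, P b -> ord_least P <= b.
Proof.
move=> [a Pa]; rewrite /ord_least; case: xgetP => [_ -> []//|none].
exfalso; elim/(well_founded_ind ord_lt_wf): a Pa => a IH Pa.
apply: (none a); split=> // b Pb; rewrite leNgt; apply/negP => ba.
exact: IH ba Pb.
Qed.

Lemma ord_least_le (P : set ord) b : P b -> ord_least P <= b.
Proof. by move=> Pb; have [|_] := @ord_least_spec P; [exists b|apply]. Qed.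

Lemma ord_least_mem (P : set ord) : (exists a, P a) -> P (ord_least P).
Proof. by move=> /ord_least_spec[]. Qed.

Lemma lt_ord_sup (P : set ord) a : a < ord_sup P -> exists2 b, P b & a < b.
Proof.
move=> aP; apply: contrapT => none; have : ord_sup P <= a.
  apply: ord_least_le => b Pb; rewrite leNgt; apply/negP => ab.
  by apply: none; exists b.
by rewrite leNgt aP.
Qed.

Lemma ord_wo_type (A : woType) : exists f : ord_sort (\pi_ord A) -> A, wo_iso f.
Proof.
have : \pi_ord (repr (\pi_ord A)) = \pi_ord A by rewrite reprK.
by move=> /eqmodP/asboolP.
Qed.

Lemma wo_iso_card (A B : woType) (f : A -> B) : wo_iso f -> [set: A] #= [set: B].
Proof.
move=> [[g fK gK] _]; apply: Cantor_Bernstein.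
  by apply: (@card_le_inj _ _ _ _ f) => // x x' _ _ /(can_inj fK).
by apply: (@card_le_inj _ _ _ _ g) => // x x' _ _ /(can_inj gK).
Qed.

(** Well-ordering [A] itself, as a sigma type, keeps the well-ordered type in
    the universe of [wo_sort]. *)
Lemma card_ord_exists (T : Type) (A : set T) : exists a : ord, A #= [set: a].
Proof.
pose S := {x : T | A x}.
pose ES := HB.pack_for eqType S (gen_eqMixin S).
have [R RP] := @well_ordering_principle ES.
exists (\pi_ord (@WoType S R RP)).
have [f fI] := ord_wo_type (@WoType S R RP).
apply: card_eq_trans (card_esym (wo_iso_card fI)); apply: Cantor_Bernstein.
  apply: (@card_le_rel _ _ _ _ (fun x y => x = sval y)) => [x Ax|x x' y _ _ -> //].
  by exists (exist _ x Ax).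
apply: (@card_le_inj _ _ _ _ (fun y : S => sval y)) => [[]//|x x' _ _].
exact: eq_sig_hprop.
Qed.

Lemma ord_le_card (a b : ord) : a <= b -> [set: a] #<= [set: b].
Proof.
move=> /asboolP[f /init_inj fI].
by apply: (@card_le_inj _ _ _ _ f) => // x x' _ _ /fI.
Qed.

Lemma ord_card_eq T (A : set T) : A #= [set: ord_card A].
Proof. exact: (ord_least_mem (card_ord_exists A)). Qed.

Lemma ord_card_le_ord T (A : set T) (b : ord) :
  (ord_card A <= b) = (A #<= [set: b]).
Proof.
apply/idP/idP => [/ord_le_card|Ab].
  by rewrite -(card_le_eql (ord_card_eq A)).
rewrite leNgt; apply/negP => lt.
have : ord_card A <= b.
  apply: ord_least_le; apply: Cantor_Bernstein => //.
  by rewrite (card_le_eqr (ord_card_eq A)); apply: ord_le_card; exact: ltW.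
by rewrite leNgt lt.
Qed.

Lemma ord_card_le T U (A : set T) (B : set U) :
  (ord_card A <= ord_card B) = (A #<= B).
Proof. by rewrite ord_card_le_ord (card_le_eqr (ord_card_eq B)). Qed.

Lemma card_le_total T U (A : set T) (B : set U) : (A #<= B) || (B #<= A).
Proof. by rewrite -!ord_card_le le_total. Qed.

Lemma ord_card_cardinal (T : Type) (A : set T) : is_cardinal (ord_card A).
Proof.
apply/le_anti; rewrite ord_card_le_ord card_lexx /= ord_card_le.
by rewrite (card_le_eql (ord_card_eq A)) card_lexx.
Qed.

Lemma cardinal_le T (A : set T) (a : ord) :
  is_cardinal a -> (a <= ord_card A) = ([set: a] #<= A).
Proof. by move=> {1}<-; rewrite ord_card_le. Qed.

Lemma cardinal_gt T (A : set T) (a : ord) :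
  is_cardinal a -> (ord_card A < a) = ~~ ([set: a] #<= A).
Proof. by move=> ca; rewrite ltNge cardinal_le. Qed.

Lemma card_lt_succ (a b : ord) : b < card_succ a -> ord_card [set: b] <= a.
Proof.
move=> ba; rewrite leNgt; apply/negP => ab.
have : card_succ a <= ord_card [set: b].
  by apply: ord_least_le; split=> //; exact: ord_card_cardinal.
move=> /le_trans/(_ (_ : ord_card [set: b] <= b)); rewrite ord_card_le_ord.
by move=> /(_ (card_lexx _)); rewrite leNgt ba.
Qed.

(** Cantor's diagonal argument, on an injective relation. *)
Lemma lt_pow2 (a : ord) : a < pow2 a.
Proof.
rewrite ltNge ord_card_le_ord; apply/negP => /card_le_exrel[R [Rtot Rinj]].
have /boolp.choice[f fP] (X : a -> bool) : exists y, R X y.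
  by have [y _ XY] := Rtot X I; exists y.
pose Y y := ~~ `[< exists X, f X = y /\ X y >].
have : Y (f Y) = ~~ Y (f Y).
  rewrite {1}/Y; congr (~~ _); apply/asboolP/idP => [[X [fXY]]|YY].
    by rewrite (_ : X = Y) //; apply: Rinj (fP X) _; rewrite fXY; exact: fP.
  by exists Y.
by case: (Y (f Y)).
Qed.

Lemma card_succP (a : ord) : is_cardinal (card_succ a) /\ a < card_succ a.
Proof.
apply: (@ord_least_mem [set b | is_cardinal b /\ a < b]).
by exists (pow2 a); split; [exact: ord_card_cardinal|exact: lt_pow2].
Qed.

Lemma card_succ_le (a b : ord) : is_cardinal b -> a < b -> card_succ a <= b.
Proof. by move=> cb ab; apply: ord_least_le. Qed.

Lemma seg_wo (A : woType) (x : A) :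
  well_order (fun y z : {y : A | y < x} => sval y <= sval z).
Proof.
apply: antisymmetric_well_order => [[y yx] [z zx] /= /le_anti yz|P [p Pp]].
  exact: eq_exist.
have [|_ [z Pz <-] zmin] := @wo_min A (fun y => exists2 z, z \in P & sval z = y).
  by exists (sval p), p.
by exists z; split=> // t Pt; apply: zmin; exists t.
Qed.

(** The ordinal of the elements below [x]; it identifies the elements of [a]
    with the ordinals below [a] ([seg_lt], [seg_mono], [seg_surj]). *)
Definition seg (a : ord) (x : a) : ord := \pi_ord (WoType (@seg_wo (repr a) x)).

Lemma segP (a : ord) (x : a) : exists f : seg x -> a,
  initial_embedding f /\ forall y, y < x <-> exists z, f z = y.
Proof.
have [f fI] := ord_wo_type (WoType (@seg_wo (repr a) x)).
pose g (z : WoType (@seg_wo (repr a) x)) : a := sval z.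
have gI : @initial_embedding (WoType (@seg_wo (repr a) x)) (repr a) g.
  split=> [//|[y yx] z /= zy].
  by exists (exist _ z (le_lt_trans zy yx)).
exists (g \o f); split; first exact: init_comp (iso_init fI) gI.
move=> y; split=> [yx|[z <-]]; last exact: (svalP (f z)).
have [[h fK hK] _] := fI.
by exists (h (exist _ y yx)); rewrite /= hK.
Qed.

Lemma ord_init_le (a b : ord) (f : a -> b) : initial_embedding f -> a <= b.
Proof. by move=> fI; apply/asboolP; exists f. Qed.

Lemma seg_lt (a : ord) (x : a) : seg x < a.
Proof.
have [f [fI fx]] := segP x; rewrite lt_neqAle (ord_init_le fI) andbT.
apply/eqP => E; have [g gI] : exists g : a -> seg x, initial_embedding g.
  by apply/asboolP; have := lexx a; rewrite -{2}E.
(* the composite of g and f fixes x, which is not in the range of f *)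
have := init_uniq (init_comp gI fI) (@init_id (repr a)) x => /= E'.
by have := (fx x).2 (ex_intro _ _ E'); rewrite ltxx.
Qed.

(** The segment of [x] embeds in that of [y], and an isomorphism between them
    would be the identity, yet [x] belongs to the second one only. *)
Lemma seg_mono (a : ord) : {mono (@seg a) : x y / x <= y}.
Proof.
apply: le_mono => x y xy; have [f [fI fx]] := segP x; have [g [gI gy]] := segP y.
have /boolp.choice[h hP] z : exists t, g t = f z.
  by apply/gy; apply: lt_trans xy; apply/fx; exists z.
have hI : initial_embedding h.
  split=> [z t|z t]; first by rewrite -gI.1 !hP fI.1.
  move=> tz; have /fI.2[u uE] : g t <= f z by rewrite -hP gI.1.
  by exists u; apply: (init_inj gI); rewrite hP.
rewrite lt_neqAle (ord_init_le hI) andbT; apply/eqP => E.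
have [k kI] : exists k : seg y -> seg x, initial_embedding k.
  by apply/asboolP; have := lexx (seg y); rewrite -{2}E.
have /gy[z gz] := xy; have := init_uniq (init_comp kI hI) (@init_id _) z => /= kz.
have : x = f (k z) by rewrite -hP kz.
by move=> E'; have := (fx x).2 (ex_intro _ _ (esym E')); rewrite ltxx.
Qed.

Lemma seg_inj (a : ord) : injective (@seg a).
Proof. exact: inc_inj (@seg_mono a). Qed.

Lemma seg_surj (a b : ord) : b < a -> exists x : a, seg x = b.
Proof.
move=> ba; have [f [x fI fx]] := ord_ltP ba; have [g [gI gx]] := segP x.
have fg z : exists t, g t = f z by apply/gx/fx; exists z.
have gf z : exists t, f t = g z by apply/fx/gx; exists z.
have [h hP] := boolp.choice fg; have [k kP] := boolp.choice gf.
exists x; apply/le_anti/andP; split.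
  apply: (@ord_init_le _ _ k); split=> [z t|z t tz].
    by rewrite -fI.1 !kP gI.1.
  have /gI.2[u gu] : f t <= g z by rewrite -kP fI.1.
  by exists u; apply: (init_inj fI); rewrite kP.
apply: (@ord_init_le _ _ h); split=> [z t|z t tz].
  by rewrite -gI.1 !hP fI.1.
have /fI.2[u gu] : g t <= f z by rewrite -hP gI.1.
by exists u; apply: (init_inj gI); rewrite hP.
Qed.

(** * Products and unions of infinite cardinals *)

Lemma card_le_prod T T' U U' (A : set T) (A' : set T') (B : set U) (B' : set U') :
  A #<= A' -> B #<= B' -> A `*` B #<= A' `*` B'.
Proof.
move=> /card_le_exrel[R [Rtot Rinj]] /card_le_exrel[S [Stot Sinj]].
apply: (@card_le_rel _ _ _ _ (fun p q => R p.1 q.1 /\ S p.2 q.2)).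
  move=> [x u] [/= /Rtot[y A'y xy] /Stot[v B'v uv]].
  by exists (y, v).
move=> [x u] [x' u'] q _ _ [/= xq uq] [/= xq' uq'].
by rewrite (Rinj _ _ _ xq xq') (Sinj _ _ _ uq uq').
Qed.

Lemma card_option_le (T : Type) :
  infinite_set [set: T] -> [set: option T] #<= [set: T].
Proof.
move=> /infiniteP/card_le_exrel[R [Rtot Rinj]].
have /boolp.choice[i iP] n : exists x, R n x.
  by have [//|x _ nx] := Rtot n; exists x.
have iI m n : i m = i n -> m = n.
  by move=> mn; apply: Rinj (iP m) _; rewrite mn.
(* the point added is sent to the first term of a sequence that is shifted *)
apply: (@card_le_rel _ _ _ _ (fun o y =>
  match o with
  | None => y = i 0%N
  | Some x => (exists2 n, x = i n & y = i n.+1) \/ (forall n, x <> i n) /\ y = x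
  end)).
  move=> [x|] _; last by exists (i 0%N).
  have [[n ->]|none] := pselect (exists n, x = i n).
    by exists (i n.+1) => //; left; exists n.
  by exists x => //; right; split=> // n xn; apply: none; exists n.
move=> [x|] [x'|] y _ _ //.
- case=> [[n -> ->]|[nx ->]].
    by move=> [[n' -> /iI[->]]|[nx' E]] //; case: (nx' n.+1).
  by move=> [[n' _ E]|[_ ->]] //; case: (nx n'.+1).
- by move=> [[n _ ->]|[nx ->]] => [/iI|/nx].
- by move=> -> [[n _ /iI]|[nx /esym/nx]].
Qed.

Lemma finite_option (T : Type) :
  finite_set [set: T] -> finite_set [set: option T].
Proof.
move=> finT; apply: (@sub_finite_set _ _ ([set None] `|` some @` [set: T])).
  by move=> [x|] _; [right; exists x|left].
by rewrite finite_setU; split; [exact: finite_set1|exact: finite_image].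
Qed.

Lemma finite_prod (T U : Type) :
  finite_set [set: T] -> finite_set [set: U] -> finite_set [set: T * U].
Proof. by rewrite -setXTT; exact: finite_setX. Qed.

Section Squares.
Variable a : ord.
Implicit Types p q : a * a.

Definition pair_max p : a := Order.max p.1 p.2.

(** Goedel's order on pairs: below a given pair, the entries are bounded by
    its larger entry. *)
Definition pair_le p q :=
  (pair_max p < pair_max q) || (pair_max p == pair_max q) &&
  ((p.1 < q.1) || (p.1 == q.1) && (p.2 <= q.2)).

Lemma pair_le_wo : well_order pair_le.
Proof.
apply: antisymmetric_well_order => [p q|P [p0 Pp0]].
  rewrite /pair_le (eq_sym (pair_max q)) (eq_sym q.1).
  case: ltgtP => //= _; case: ltgtP => //= pq1 /le_anti pq2.
  by rewrite (surjective_pairing p) pq1 pq2 -surjective_pairing.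
have [|_ [p Pp <-] pmin] :=
  @wo_min (repr a) (fun m => exists2 p, p \in P & pair_max p = m).
  by exists (pair_max p0), p0.
have [|_ [q [Pq qp] <-] qmin] := @wo_min (repr a)
  (fun m => exists2 q, q \in P /\ pair_max q = pair_max p & q.1 = m).
  by exists p.1, p.
have [|_ [r [Pr rp rq] <-] rmin] := @wo_min (repr a)
  (fun m => exists2 r, [/\ r \in P, pair_max r = pair_max p & r.1 = q.1] & r.2 = m).
  by exists q.2, q.
exists r; split=> // s Ps; rewrite /pair_le rp rq.
have : pair_max p <= pair_max s by apply: pmin; exists s.
rewrite le_eqVlt => /predU1P[ps|->//]; rewrite ps eqxx ltxx /=.
have : q.1 <= s.1 by apply: qmin; exists s.
rewrite le_eqVlt => /predU1P[qs|->//]; rewrite qs eqxx ltxx /=.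
by apply: rmin; exists s.
Qed.

End Squares.

(** Hessenberg's theorem.  If [a] injects in no smaller ordinal, a
    proper initial segment of the order [pair_le] embeds in the square of some
    [seg m] with one point added, hence by induction has smaller cardinality
    than [a].  So [a] does not embed in a proper initial segment, and the whole
    order embeds in [a]. *)
Lemma card_square_le (a : ord) :
  infinite_set [set: a] -> [set: a * a] #<= [set: a].
Proof.
elim/(well_founded_ind ord_lt_wf): a => a IH a_inf.
have [[b ba ab]|nab] := pselect (exists2 b : ord, b < a & [set: a] #<= [set: b]).
  have b_inf : infinite_set [set: b] by move=> /(card_le_finite ab).
  rewrite -setXTT; apply: card_le_trans (card_le_prod ab ab) _; rewrite setXTT.
  by apply: card_le_trans (IH _ ba b_inf) _; apply: ord_le_card; exact: ltW.
have [[f fI]|[f /init_inj fI]] :=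
    init_total (repr a) (WoType (@pair_le_wo a)); last first.
  by apply: (@card_le_inj _ _ _ _ f) => // p q _ _ /fI.
have [fsurj|/existsNP[q nq]] := pselect (forall q, exists x, f x = q).
  apply: (@card_le_rel _ _ _ _ (fun p x => f x = p)) => [p _|p q x _ _ <- //].
  by have [x <-] := fsurj p; exists x.
exfalso; pose m := pair_max q.
have fm x : pair_max (f x) <= m.
  have /orP[qf|] := wo_le_total q (f x); first by case: nq; exact: fI.2 qf.
  by rewrite /= /pair_le => /orP[/ltW//|/andP[/eqP-> _]].
have {fm} am : [set: a] #<= [set: option (seg m) * option (seg m)].
  have [g [gI gm]] := segP m.
  pose R (x : a) (o : option (seg m)) := if o is Some y then x = g y else x = m.
  have Rtot x : x <= m -> exists o, R x o.
    rewrite le_eqVlt => /predU1P[->|/gm[y <-]]; first by exists None.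
    by exists (Some y).
  have Rinj x x' o : R x o -> R x' o -> x = x' by case: o => [y|] /= -> ->.
  apply: (@card_le_rel _ _ _ _ (fun x o => R (f x).1 o.1 /\ R (f x).2 o.2)).
    move=> x _; have := fm x; rewrite /pair_max ge_max => /andP[/Rtot[o1 ?] /Rtot[o2 ?]].
    by exists (o1, o2).
  move=> x x' [o1 o2] _ _ /= [x1 x2] [x1' x2']; apply: (init_inj fI).
  rewrite (surjective_pairing (f x)) (surjective_pairing (f x')).
  by rewrite (Rinj _ _ _ x1 x1') (Rinj _ _ _ x2 x2').
have [m_fin|m_inf] := pselect (finite_set [set: seg m]).
  apply: a_inf; apply: card_le_finite am _.
  by apply: finite_prod; exact: finite_option.
apply: nab; exists (seg m); first exact: seg_lt.
apply: card_le_trans am _; apply: card_le_trans (IH _ (seg_lt m) m_inf).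
by rewrite -!setXTT; apply: card_le_prod; exact: card_option_le.
Qed.

(** An element [x] of [A] is coded by a pair of elements of [a]: the code of an
    [i] such that [x] is in [F i], and the code of [x] in [F i]. *)
Lemma card_union_le I T (J : set I) (F : I -> set T) (A : set T) (a : ord) :
  infinite_set [set: a] -> J #<= [set: a] ->
  (forall i, J i -> F i #<= [set: a]) ->
  (forall x, A x -> exists2 i, J i & F i x) -> A #<= [set: a].
Proof.
move=> a_inf /card_le_exrel[R [Rtot Rinj]] Fa AF.
have /boolp.choice[S SP] i : exists S : T -> a -> Prop, J i ->
    (forall x, F i x -> exists y, S x y) /\
    (forall x x' y, S x y -> S x' y -> x = x').
  have [/Fa/card_le_exrel[S [Stot Sinj]]|nJ] := pselect (J i); last first.
    by exists (fun _ _ => False).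
  by exists S; split=> // x /Stot[y _]; exists y.
apply: card_le_trans (card_square_le a_inf).
apply: (@card_le_rel _ _ _ _ (fun x p => exists i, [/\ J i, R i p.1 & S i x p.2])).
  move=> x /AF[i Ji Fix]; have [y _ iy] := Rtot _ Ji.
  by have [/(_ _ Fix)[z xz] _] := SP i Ji; exists (y, z) => //; exists i.
move=> x x' p _ _ [i [Ji ip xp]] [i' [_ ip' xp']].
by have [_ /(_ x x' p.2)] := SP i Ji; apply=> //; rewrite (Rinj _ _ _ ip ip').
Qed.

Lemma card_rank_le T (A : set T) (c : ord) (rk : T -> ord) :
  (forall s, A s -> rk s < c) ->
  (forall s s', A s -> A s' -> rk s = rk s' -> s = s') -> A #<= [set: c].
Proof.
move=> rkc rkI; apply: (@card_le_rel _ _ _ _ (fun s x => seg x = rk s)).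
  by move=> s /rkc/seg_surj[x sx]; exists x.
by move=> s s' x As As' xs xs'; apply: rkI => //; rewrite -xs -xs'.
Qed.

Lemma card_le_rank T (A : set T) (c : ord) : A #<= [set: c] -> exists rk : T -> ord,
  (forall s, A s -> rk s < c) /\
  (forall s s', A s -> A s' -> rk s = rk s' -> s = s').
Proof.
move=> /card_le_exrel[R [Rtot Rinj]].
have /boolp.choice[rk rkP] s : exists a : ord, A s -> exists2 x : c, seg x = a & R s x.
  have [/Rtot[x _ sx]|nA] := pselect (A s); last by exists ord_zero.
  by exists (seg x) => _; exists x.
exists rk; split=> [s /rkP[x <- _]|s s' /rkP[x <- sx] /rkP[x' <- sx'] /seg_inj E].
  exact: seg_lt.
by apply: Rinj sx _; rewrite E.
Qed.

Lemma cardinal_lt_not_le (c b : ord) :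
  is_cardinal c -> b < c -> ~ ([set: c] #<= [set: b]).
Proof.
move=> cc bc; apply/negP; rewrite -cardinal_gt //; apply: le_lt_trans bc.
by rewrite ord_card_le_ord.
Qed.

(** Otherwise [c] would inject in [b] with one point added, which has the
    cardinality of [b], since [b] would be infinite. *)
Lemma infinite_cardinal_limit (c b : ord) :
  is_cardinal c -> infinite_set [set: c] -> b < c ->
  exists2 d : ord, b < d & d < c.
Proof.
move=> cc c_inf bc; apply: contrapT => none.
have cb : [set: c] #<= [set: option b].
  apply: (@card_le_rel _ _ _ _ (fun x o =>
      seg x = if o is Some y then seg y else b)).
    move=> x _; have : seg x <= b.
      rewrite leNgt; apply/negP => bx; apply: none.
      by exists (seg x) => //; exact: seg_lt.
    rewrite le_eqVlt => /predU1P[->|/seg_surj[y yx]]; first by exists None.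
    by exists (Some y).
  by move=> x x' o _ _ <- /seg_inj.
have [b_fin|b_inf] := pselect (finite_set [set: b]).
  by apply: c_inf; apply: card_le_finite cb _; exact: finite_option.
apply: (cardinal_lt_not_le cc bc); apply: card_le_trans cb _.
exact: card_option_le.
Qed.

Lemma card_prod_lt T U (A : set T) (B : set U) (c : ord) :
  is_cardinal c -> infinite_set [set: c] ->
  ord_card A < c -> ord_card B < c -> ord_card (A `*` B) < c.
Proof.
move=> cc c_inf Ac Bc; pose d : ord := Order.max (ord_card A) (ord_card B).
have dc : d < c by rewrite gt_max Ac Bc.
have Ad : A #<= [set: d] by rewrite -ord_card_le_ord le_max lexx.
have Bd : B #<= [set: d] by rewrite -ord_card_le_ord le_max lexx orbT.
have ABd : A `*` B #<= [set: d * d] by rewrite -setXTT; exact: card_le_prod.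
have [d_fin|d_inf] := pselect (finite_set [set: d]).
  rewrite cardinal_gt //; apply/negP => cAB; apply: c_inf.
  by apply: card_le_finite (card_le_trans cAB ABd) _; exact: finite_prod.
apply: le_lt_trans dc; rewrite ord_card_le_ord.
exact: card_le_trans ABd (card_square_le d_inf).
Qed.

(** Regularity of successor cardinals: if the ranks were unbounded, then [b^+]
    would be a union of [b] segments, each of size at most [b]. *)
Lemma card_succ_regular T (G : set T) (b : ord) (rk : T -> ord) :
  infinite_set [set: b] -> G #<= [set: b] ->
  (forall s, G s -> rk s < card_succ b) ->
  exists2 d : ord, d < card_succ b & forall s, G s -> rk s <= d.
Proof.
move=> b_inf Gb rkb; apply: contrapT => none.
have [cs bs] := card_succP b; apply: (cardinal_lt_not_le cs bs).
apply: (@card_union_le _ _ G (fun s => [set x | seg x < rk s])) => //.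
  move=> s Gs; apply: (@card_le_trans _ _ _ [set: rk s]).
    by apply: (card_rank_le (rk := @seg _)) => // x x' _ _ /seg_inj.
  by rewrite -ord_card_le_ord; exact/card_lt_succ/rkb.
move=> x _; apply: contrapT => nx; apply: none.
exists (seg x); first exact: seg_lt.
move=> s Gs; rewrite leNgt; apply/negP => xs; apply: nx.
by exists s.
Qed.

(** * Cofinal families *)

Lemma cofinalityP (mu : ord) : exists C : set mu,
  (forall x, exists2 y, C y & x <= y) /\ ord_card C = cofinality mu.
Proof.
have [|C HC CE] := @ord_least_mem [set ord_card C | C in
    [set C : set mu | forall x, exists2 y, C y & x <= y]].
  by exists (ord_card [set: mu]), [set: mu] => // x; exists x.
by exists C.
Qed.

Lemma cf_subsetsP (alpha kappa : ord) : exists C : set (alpha -> Prop),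
  [/\ ord_card C = cf_subsets alpha kappa,
      forall y, C y -> ord_card y = kappa &
      forall x : alpha -> Prop, ord_card x = kappa -> exists2 y, C y & x `<=` y].
Proof.
have [|C [HC1 HC2] CE] := @ord_least_mem [set ord_card C | C in
    [set C : set (alpha -> Prop) | C `<=` @subsets_of_card alpha kappa /\
      forall x, subsets_of_card kappa x -> exists2 y, C y & x `<=` y]].
  eexists; exists (@subsets_of_card alpha kappa) => //.
  by split=> // x Kx; exists x.
by exists C; split.
Qed.

(** The bound on [cf_subsets], transported from ordinals to sets [B] of size
    less than [mu].  It is stated for ranges of functions, which may be small,
    so that it makes sense for a [B] with fewer than [kappa] elements too. *)
Lemma cover_family (mu kappa : ord) T (B : set T) :
  is_cardinal mu -> infinite_set [set: mu] ->
  is_cardinal kappa -> infinite_set [set: kappa] ->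
  (forall alpha : ord, alpha < mu -> cf_subsets alpha kappa < mu) ->
  ord_card B < mu ->
  exists C : set (T -> Prop), [/\ ord_card C < mu,
    forall y, C y -> y #<= [set: kappa] &
    forall e : kappa -> T, (forall k, B (e k)) ->
      exists2 y, C y & forall k, y (e k)].
Proof.
move=> cmu mu_inf ck k_inf cf_small Bmu.
have [kB|Bk] := orP (card_le_total [set: kappa] B); last first.
  exists [set (B : T -> Prop)]; split=> [|y ->//|e eB]; last by exists B.
  rewrite cardinal_gt //; apply/negP => /card_le_finite fin; apply: mu_inf.
  exact/fin/finite_set1.
have [C' [C'E C'k C'cov]] := cf_subsetsP (ord_card B) kappa.
have C'mu : ord_card C' < mu by rewrite C'E; exact: cf_small.
have : B #<= [set: ord_card B] by rewrite -ord_card_le_ord.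
move=> /[dup] /(card_le_trans kB)/card_le_exrel[S [Stot Sinj]] /card_le_exrel[R [Rtot Rinj]].
exists [set (fun x => exists2 z, y z & R x z) | y in C']; split.
- by apply: le_lt_trans C'mu; rewrite ord_card_le; exact: card_image_le.
- move=> _ [y C'y <-]; apply: (@card_le_trans _ _ _ y).
    apply: (@card_le_rel _ _ _ _ R) => [x [z yz xz]|x x' z _ _]; first by exists z.
    exact: Rinj.
  by rewrite -ord_card_le_ord (C'k y C'y).
move=> e eB.
have /boolp.choice[i iP] (k : kappa) : exists z, S k z.
  by have [//|z _] := Stot k; exists z.
have /boolp.choice[r rP] (k : kappa) : exists z, R (e k) z.
  by have [//|z _] := Rtot (e k); exists z.
(* the range of the injection i is added so that x has size exactly kappa *)
pose x : ord_card B -> Prop := fun z => range i z \/ range r z.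
have [|y C'y xy] := C'cov x.
  apply/le_anti/andP; split.
    rewrite ord_card_le_ord; apply: (@card_union_le _ _ [set: bool]
        (fun b => if b then range i else range r)) => //.
    - apply: card_le_trans (iffLR (infiniteP _) k_inf).
      exact/finite_set_countable/finite_finset.
    - by move=> [] _; exact: card_image_le.
    - by move=> z [zi|zr]; [exists true|exists false].
  rewrite cardinal_le //; apply: (@card_le_inj _ _ _ _ i) => [k _|k k' _ _ ii].
    by left; exists k.
  by apply: Sinj (iP k) _; rewrite ii.
exists (fun x0 => exists2 z, y z & R x0 z); first by exists y.
by move=> k; exists (r k) => //; apply: xy; right; exists k.
Qed.

(** * Decreasing the size of a catching set *)

Lemma card_rank_below T (A : set T) (c d : ord) (rk : T -> ord) :
  is_cardinal c -> infinite_set [set: c] -> d < c ->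
  (forall s s', A s -> A s' -> rk s = rk s' -> s = s') ->
  exists2 e : ord, e < c & [set s | A s /\ rk s <= d] #<= [set: e].
Proof.
move=> cc c_inf /(infinite_cardinal_limit cc c_inf)[e de ec] rkI.
exists e => //; apply: (@card_rank_le _ _ _ rk) => [s [_ sd]|s s' [As _] [As' _]].
  exact: le_lt_trans sd de.
exact: rkI.
Qed.

Lemma pigeonhole_gt I T (J : set I) (F : I -> set T) (A : set T) (tau : ord) :
  infinite_set [set: tau] -> J #<= [set: tau] ->
  (forall x, A x -> exists2 i, J i & F i x) ->
  tau < ord_card A -> exists2 i, J i & tau < ord_card (F i).
Proof.
move=> tau_inf Jtau AF; apply: contraPP => none; apply/negP.
rewrite -leNgt ord_card_le_ord; apply: (@card_union_le _ _ J F) => // i Ji.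
rewrite -ord_card_le_ord leNgt; apply/negP => lt; apply: none.
by exists i.
Qed.

Lemma card_succ_iterE (mu xi : ord) : card_succ_iter mu xi =
  ord_sup (mu |` [set b | exists eta (h : eta < xi),
                            b = card_succ (card_succ_iter mu eta)]).
Proof.
rewrite /card_succ_iter Fix_eq // => x f g fg.
suff -> : f = g by [].
by apply: functional_extensionality_dep => y; apply: functional_extensionality_dep.
Qed.

Lemma lt_card_succ_iter (mu xi a : ord) : a < card_succ_iter mu xi ->
  a < mu \/ exists2 eta : ord, eta < xi & a < card_succ (card_succ_iter mu eta).
Proof.
rewrite card_succ_iterE => /lt_ord_sup[b [->|[eta [lt ->]]] ab]; first by left.
by right; exists eta.
Qed.

(** The descent only depends on two properties of the relation between a set of
    traces and the subsets of [nu] that it catches, which are taken here as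
    hypotheses: [catches_split] and [catches_small]. *)
Section Descent.
Variables (mu kappa tau : ord).
Hypotheses (cmu : is_cardinal mu) (mu_inf : infinite_set [set: mu]).
Hypotheses (cf_mu : cofinality mu = kappa).
Hypotheses (tau_inf : infinite_set [set: tau]) (k_tau : kappa <= tau).
Variables (T Q : Type) (catches : set T -> Q -> Prop).
Hypothesis catches_split : forall I (J : set I) (F : I -> set T) (S : set T) q,
  J #<= [set: kappa] -> (forall s, S s -> exists2 i, J i & F i s) ->
  catches S q -> exists2 i, J i & catches (F i) q.
Hypothesis catches_small : forall S q, catches S q ->
  exists G : set T, [/\ G `<=` S, ord_card G < mu &
    forall S', G `<=` S' -> catches S' q].

Let popular (S : set T) := tau < ord_card [set q | catches S q].

Lemma popular_split I (J : set I) (F : I -> set T) (S : set T) :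
  J #<= [set: kappa] -> (forall s, S s -> exists2 i, J i & F i s) ->
  popular S -> exists2 i, J i & popular (F i).
Proof.
move=> Jk SF; apply: pigeonhole_gt => // [|q]; last exact: catches_split.
exact: card_le_trans Jk (ord_le_card k_tau).
Qed.

(** A set of size at most [mu] is the union of its segments along a cofinal sequence
    of length [kappa]. *)
Lemma descent_limit (S : set T) : S #<= [set: mu] -> popular S ->
  exists2 B, ord_card B < mu & popular B.
Proof.
move=> /card_le_rank[rk [rk_mu rkI]] popS.
have [C [Ccof CE]] := cofinalityP mu.
have [||c _ popc] := @popular_split _ C (fun c => [set s | S s /\ rk s <= seg c]) S _ _ popS.
- by rewrite -ord_card_le_ord CE cf_mu.
- move=> s Ss; have [x sx] := seg_surj (rk_mu s Ss).
  by have [c Cc xc] := Ccof x; exists c => //; split=> //; rewrite -sx seg_mono.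
eexists; last exact: popc.
have [e emu Se] := card_rank_below cmu mu_inf (seg_lt c) rkI.
by apply: le_lt_trans emu; rewrite ord_card_le_ord.
Qed.

(** Each [q] is caught by fewer than [mu] elements of [S], hence by a proper
    segment of [S]; there are [b^+] segments, at most [tau] many. *)
Lemma descent_succ (S : set T) (b : ord) : mu <= b -> card_succ b <= tau ->
  S #<= [set: card_succ b] -> popular S ->
  exists S' : set T, [/\ S' `<=` S, S' #<= [set: b] & popular S'].
Proof.
move=> mub btau /card_le_rank[rk [rk_b rkI]].
have b_inf : infinite_set [set: b].
  by move=> fin; apply: mu_inf; apply: card_le_finite (ord_le_card mub) fin.
have [cs bs] := card_succP b.
have s_inf : infinite_set [set: card_succ b].
  move=> fin; apply: b_inf; apply: card_le_finite fin.
  by apply: ord_le_card; exact: ltW.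
move=> /(@pigeonhole_gt _ _ [set: card_succ b]
  (fun w => [set q | catches [set s | S s /\ rk s <= seg w] q]) _ _ tau_inf).
case=> [|q qS|w _ popw].
- exact: ord_le_card.
- have [G [GS Gmu GP]] := catches_small qS.
  have [||d db Gd] := @card_succ_regular _ G b rk b_inf.
  + by rewrite -ord_card_le_ord; exact/ltW/(lt_le_trans Gmu).
  + by move=> s /GS/rk_b.
  have [w wd] := seg_surj db; exists w => //; apply: GP => s Gs.
  by split; [exact: GS|rewrite wd; exact: Gd].
exists [set s | S s /\ rk s <= seg w]; split=> [s []//||//].
have [e eb Se] := card_rank_below cs s_inf (seg_lt w) rkI.
by apply: card_le_trans Se _; rewrite -ord_card_le_ord; exact: card_lt_succ.
Qed.

(** Every ordinal below [mu^{+xi}] is below [mu] or below [(mu^{+eta})^+] for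
    some [eta < xi], which splits [S] in [|xi| <= kappa] pieces; this treats
    successor and limit [xi] uniformly. *)
Lemma descent (xi : ord) (S : set T) : xi < card_succ kappa ->
  S #<= [set: card_succ_iter mu xi] -> ord_card S <= tau -> popular S ->
  exists2 B, ord_card B < mu & popular B.
Proof.
elim/(well_founded_ind ord_lt_wf): xi S => xi IH S xik Sxi Stau popS.
have [[eta [etaxi Seta]]|nS] :=
    pselect (exists eta : ord, eta < xi /\ S #<= [set: card_succ_iter mu eta]).
  exact: (IH _ etaxi S (lt_trans etaxi xik)).
have [rk [rk_xi rkI]] := card_le_rank Sxi.
have [[z0 _]|none] := pselect (exists z : xi, True); last first.
  apply: descent_limit popS; apply: (@card_rank_le _ _ _ rk) => // s /rk_xi.
  move=> /lt_card_succ_iter[//|[eta /seg_surj[z _] _]].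
  by case: none; exists z.
(* The maximum puts the ordinals below mu in every piece; when mu is the
   larger term, the piece falls under [descent_limit]. *)
pose p (z : xi) : ord := Order.max mu (card_succ (card_succ_iter mu (seg z))).
have [||z _ popz] :=
    @popular_split _ [set: xi] (fun z => [set s | S s /\ rk s < p z]) S _ _ popS.
- by rewrite -ord_card_le_ord; exact: card_lt_succ.
- move=> s Ss; have [smu|[eta /seg_surj[z <-] seta]] := lt_card_succ_iter (rk_xi s Ss).
    by exists z0 => //; split=> //; rewrite lt_max smu.
  by exists z => //; split=> //; rewrite lt_max seta orbT.
have Sz : [set s | S s /\ rk s < p z] #<= [set: p z].
  by apply: (@card_rank_le _ _ _ rk) => [s []//|s s' [+ _] [+ _]]; exact: rkI.
move: Sz popz; set b := card_succ_iter mu (seg z) in p *.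
rewrite /p; have [bmu|mub] := leP (card_succ b) mu; first exact: descent_limit.
have {}mub : mu <= b by rewrite leNgt; apply/negP => /(card_succ_le cmu); rewrite leNgt mub.
move=> Sz /(descent_succ mub _ Sz)[|S' [S'S S'b popS']].
  (* S has no injection into b, so that b^+ is at most |S| *)
  apply: le_trans Stau; apply: card_succ_le; first exact: ord_card_cardinal.
  rewrite ltNge ord_card_le_ord; apply/negP => Sb; apply: nS.
  by exists (seg z); split=> //; exact: seg_lt.
apply: (IH (seg z) (seg_lt z) S' _ S'b _ popS').
  exact: lt_trans (seg_lt z) xik.
apply: le_trans Stau; rewrite ord_card_le; apply: subset_card_le => s /S'S[].
by [].
Qed.

End Descent.

(** * Covering families and traces *)

Definition covering (kappa : ord) T (G : set (T -> Prop)) :=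
  forall e : kappa -> T, exists2 y, G y & forall k, y (e k).

(** If no piece is covering, then [kappa] functions from [kappa] witness this;
    as [kappa * kappa] has size [kappa], they combine in a single function that
    no member of [G] covers. *)
Lemma covering_split (kappa : ord) T (t0 : T) I (J : set I)
    (H : I -> set (T -> Prop)) (G : set (T -> Prop)) :
  infinite_set [set: kappa] -> J #<= [set: kappa] ->
  (forall y, G y -> exists2 i, J i & H i y) ->
  covering kappa G -> exists2 i, J i & covering kappa (H i).
Proof.
move=> k_inf /card_le_exrel[R [Rtot Rinj]] GH Gcov; apply: contrapT => none.
have /boolp.choice[e eP] i : exists e : kappa -> T,
    J i -> ~ exists2 y, H i y & forall k, y (e k).
  have [Ji|nJ] := pselect (J i); last by exists (fun=> t0).
  have /existsNP[e eP] : ~ covering kappa (H i) by move=> Hi; apply: none; exists i.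
  by exists e.
have /card_le_exrel[S [Stot Sinj]] := card_square_le k_inf.
have /boolp.choice[d dP] (k : kappa) : exists t, forall i a b,
    R i a -> S (a, b) k -> t = e i b.
  have [[i [a [b [ia abk]]]]|nk] := pselect (exists i a b, R i a /\ S (a, b) k).
    exists (e i b) => i' a' b' ia' abk'.
    have [aa <-] : (a, b) = (a', b') := Sinj _ _ _ abk abk'.
    by rewrite (Rinj _ i' _ ia) // aa.
  by exists t0 => i a b ia abk; case: nk; exists i, a, b.
have [y Gy yd] := Gcov d; have [i Ji iy] := GH _ Gy.
apply: (eP i Ji); exists y => // b.
have [a _ ia] := Rtot _ Ji; have [//|k _ abk] := Stot (a, b).
by rewrite -(dP _ _ _ _ ia abk).
Qed.

Lemma card_le_range (kappa : ord) (T : Type) (t0 : T) (y : T -> Prop) :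
  [set t | y t] #<= [set: kappa] ->
  exists e : kappa -> T, forall t, y t -> exists k, e k = t.
Proof.
move=> /card_le_exrel[R [Rtot Rinj]].
have /boolp.choice[e eP] (k : kappa) : exists t, forall t', R t' k -> t' = t.
  have [[t tk]|none] := pselect (exists t, R t k).
    by exists t => t' /Rinj; apply.
  by exists t0 => t' t'k; case: none; exists t'.
exists e => t /Rtot[k _ tk]; exists k.
by rewrite -(eP _ _ tk).
Qed.

(** The intersection alone would not be enough: it is the first component that
    makes it possible to recover [X] on [Y] from the trace. *)
Definition trace (T : Type) (X : T -> bool) (Y : T -> Prop) :
  (T -> Prop) * (T -> Prop) := (Y, fun n => Y n /\ X n).

Lemma card_traces (T : Type) (C : set (T -> Prop)) (kappa a : ord) :
  infinite_set [set: a] -> C #<= [set: a] -> pow2 kappa <= a ->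
  (forall Y, C Y -> Y #<= [set: kappa]) ->
  [set p : (T -> Prop) * (T -> Prop) | C p.1 /\ p.2 `<=` p.1] #<= [set: a].
Proof.
move=> a_inf Ca ka Ck; apply: (@card_union_le _ _ C
    (fun Y => [set p : (T -> Prop) * (T -> Prop) | p.1 = Y /\ p.2 `<=` Y])) => //.
  move=> Y /Ck/card_le_exrel[R [Rtot Rinj]].
  apply: (@card_le_trans _ _ _ [set: kappa -> bool]).
    apply: (@card_le_rel _ _ _ _
        (fun (p : (T -> Prop) * (T -> Prop)) (h : kappa -> bool) =>
        forall t k, Y t -> R t k -> h k <-> p.2 t)).
      move=> [_ Z] [/= _ ZY].
      exists (fun k => `[< exists t, R t k /\ Z t >]) => // t k _ tk.
      split=> [/asboolP[t' [t'k]]|Zt]; first by rewrite (Rinj _ _ _ tk t'k).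
      by apply/asboolP; exists t.
    move=> [Y1 Z1] [Y2 Z2] h [/= -> ZY1] [-> ZY2] h1 h2; congr pair.
    apply/predeqP => t; split=> Zt.
      have Yt := ZY1 _ Zt; have [k _ tk] := Rtot _ Yt.
      exact: (h2 t k Yt tk).1 ((h1 t k Yt tk).2 Zt).
    have Yt := ZY2 _ Zt; have [k _ tk] := Rtot _ Yt.
    exact: (h1 t k Yt tk).1 ((h2 t k Yt tk).2 Zt).
  by rewrite -ord_card_le_ord.
move=> [Y Z] [/= CY ZY]; by exists Y.
Qed.

(** * Functions from a small catching set *)

(** The point [m] codes a pair [(Y0, Z)], by an injection [q] of triples
    [(Y0, Z, m')] into [mu]; the third component makes every pair be coded by
    [mu] many points.  Given [X : kappa -> N -> bool], the pair to use is a
    [Y0] that contains a point of difference for any two distinct [X k], and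
    then a [Z] that contains the chosen traces of all the [X k]. *)
Lemma unbounded_family (mu kappa : ord) (N : Type) (n0 : N) (F : set (N -> bool))
    (C : set (N -> Prop)) (B : set ((N -> Prop) * (N -> Prop))) :
  is_cardinal mu -> infinite_set [set: mu] ->
  is_cardinal kappa -> infinite_set [set: kappa] ->
  (forall alpha : ord, alpha < mu -> cf_subsets alpha kappa < mu) ->
  ord_card C < mu -> (forall Y, C Y -> Y #<= [set: kappa]) ->
  covering kappa C -> ord_card B < mu ->
  (forall X, F X -> covering kappa [set Y | C Y /\ B (trace X Y)]) ->
  exists f : (N -> bool) -> mu -> kappa,
  forall X : kappa -> N -> bool, injective X -> (forall k, F (X k)) ->
  exists2 M : set mu, ord_card M = mu &
    forall m, M m -> injective (fun k => f (X k) m).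
Proof.
move=> cmu mu_inf ck k_inf cf_small Cmu Ck Ccov Bmu FB.
have [CB [CBmu CBk CBcov]] := cover_family cmu mu_inf ck k_inf cf_small Bmu.
have [k0 _] : [set: kappa] !=set0 by exact: infinite_setN0.
have [m0 _] : [set: mu] !=set0 by exact: infinite_setN0.
(* t (X, Y0) is a member Y of C that contains Y0 and where X has its trace in B *)
have /boolp.choice[t tP] (p : (N -> bool) * (N -> Prop)) :
    exists Y, F p.1 -> C p.2 -> [/\ C Y, p.2 `<=` Y & B (trace p.1 Y)].
  case: p => X Y0 /=.
  have [[FX CY0]|] := pselect (F X /\ C Y0); last first.
    by move=> nFC; exists Y0 => ? ?; case: nFC.
  have [e eP] := card_le_range n0 (Ck _ CY0).
  have [Y [CY BY] eY] := FB _ FX e; exists Y => _ _; split=> //.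
  by move=> n /eP[k <-].
have /boolp.choice[h hP] (Z : (N -> Prop) * (N -> Prop) -> Prop) :
    exists h : (N -> Prop) * (N -> Prop) -> kappa, CB Z ->
      forall t t', Z t -> Z t' -> h t = h t' -> t = t'.
  have [/CBk/(card_le_fun k0)[h [_ hI]]|nZ] := pselect (CB Z).
    by exists h => _; exact: hI.
  by exists (fun=> k0).
have [q [_ qI]] : exists q : ((N -> Prop) * ((N -> Prop) * (N -> Prop) -> Prop)) * mu -> mu,
    (forall x, ((C `*` CB) `*` [set: mu]) x -> [set: mu] (q x)) /\
    (forall x x', ((C `*` CB) `*` [set: mu]) x -> ((C `*` CB) `*` [set: mu]) x' ->
       q x = q x' -> x = x').
  apply: card_le_fun => //; apply: card_le_trans (card_square_le mu_inf).
  rewrite -setXTT; apply: card_le_prod => //.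
  by rewrite -ord_card_le_ord; exact/ltW/card_prod_lt.
have /boolp.choice[r rP] (m : mu) : exists p, forall Y Z m', C Y -> CB Z ->
    q (Y, Z, m') = m -> p = (Y, Z).
  have [[Y [Z [m' [CY CBZ qm]]]]|nm] :=
      pselect (exists Y Z m', [/\ C Y, CB Z & q (Y, Z, m') = m]).
    exists (Y, Z) => Y' Z' m'' CY' CBZ' qm'.
    by have [-> -> _] : (Y', Z', m'') = (Y, Z, m') by apply: qI; rewrite ?qm.
  exists ((fun=> True), (fun=> True)) => Y Z m' CY CBZ qm.
  by case: nm; exists Y, Z, m'.
exists (fun X m => h (r m).2 (trace X (t (X, (r m).1)))) => X XI FX.
(* all the points of difference n p are in the range of the single function d *)
have /boolp.choice[n nP] (p : kappa * kappa) : exists n, p.1 <> p.2 -> X p.1 n <> X p.2 n.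
  have [->|ne] := pselect (p.1 = p.2); first by exists n0.
  have /existsNP[n nP] : ~ forall n, X p.1 n = X p.2 n.
    by move=> XX; apply/ne/XI/funext.
  by exists n.
have [s [_ sI]] := card_le_fun k0 (card_square_le k_inf).
have /boolp.choice[d dP] (k : kappa) : exists n', forall p, s p = k -> n p = n'.
  have [[p <-]|none] := pselect (exists p, s p = k).
    by exists (n p) => p' /sI ->.
  by exists n0 => p pk; case: none; exists p.
have [Y0 CY0 Y0d] := Ccov d.
have nY0 p : Y0 (n p) by rewrite (dP (s p)).
have tXP k := tP (X k, Y0) (FX k) CY0.
have [Z CBZ Ze] := CBcov (fun k => trace (X k) (t (X k, Y0)))
                     (fun k => let: And3 _ _ Bk := tXP k in Bk).
exists (range (fun m => q (Y0, Z, m))).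
  apply/le_anti/andP; split; first by rewrite ord_card_le_ord card_leT.
  rewrite cardinal_le //.
  apply: (@card_le_inj _ _ _ _ (fun m => q (Y0, Z, m))) => [m _|m m' _ _ qm].
    by exists m.
  by have [] : (Y0, Z, m) = (Y0, Z, m') by apply: qI.
move=> _ [m _ <-] k k' /=; rewrite (rP (q (Y0, Z, m)) Y0 Z m) //= => hh.
(* the traces of X k and X k' coincide, on a set that contains n (k, k') *)
have [] := hP Z CBZ _ _ (Ze k) (Ze k') hh; move=> tt /predeqP XX.
apply: contrapT => kk'; apply: (nP (k, k') kk') => /=.
have [_ Y0t _] := tXP k; have [_ Y0t' _] := tXP k'.
have nk := Y0t _ (nY0 (k, k')); have nk' := Y0t' _ (nY0 (k, k')).
have [XX1 XX2] := XX (n (k, k')).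
by apply/idP/idP => Xn; [have [] := XX1 (conj nk Xn)|have [] := XX2 (conj nk' Xn)].
Qed.

(** * The dominating number *)

Lemma cofinality_cardinal (mu : ord) : is_cardinal (cofinality mu).
Proof. by have [C [_ <-]] := cofinalityP mu; exact: ord_card_cardinal. Qed.

(** A finite set has a largest element, which is not cofinal. *)
Lemma infinite_cofinality (mu : ord) : is_cardinal mu ->
  infinite_set [set: mu] -> infinite_set [set: cofinality mu].
Proof.
move=> cmu mu_inf fin; have [C [Ccof CE]] := cofinalityP mu.
have : finite_set C.
  by apply: card_le_finite fin; rewrite -ord_card_le_ord CE.
move=> /finite_seqP[s Cs].
have [x0 _] : [set: mu] !=set0 by exact: infinite_setN0.
have [b sb] : exists b : mu, forall x, x \in s -> x <= b.
  elim: s {Cs} => [|y s [b sb]]; first by exists x0.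
  exists (Order.max y b) => x; rewrite inE => /predU1P[->|/sb xb].
    by rewrite le_max lexx.
  by rewrite le_max xb orbT.
have [d bd /seg_surj[x xd]] := infinite_cardinal_limit cmu mu_inf (seg_lt b).
have {bd xd} bx : b < x by rewrite -(leW_mono (@seg_mono _)) xd.
have [y + xy] := Ccof x; rewrite Cs => /sb yb.
by have := le_trans xy yb; rewrite leNgt bx.
Qed.

(** Dominating families exist because [kappa] is a limit ordinal: every function
    is dominated everywhere by a larger one. *)
Lemma dominating_numberP (mu kappa : ord) :
  is_cardinal mu -> infinite_set [set: mu] ->
  is_cardinal kappa -> infinite_set [set: kappa] ->
  exists D : set (mu -> kappa),
    dominating_family D /\ ord_card D = dominating_number mu kappa.
Proof.
move=> cmu mu_inf ck k_inf.
have [|D DD DE] := @ord_least_mem [set ord_card D | D in @dominating_family mu kappa].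
  exists (ord_card [set: mu -> kappa]), setT => // f.
  have /boolp.choice[g fg] i : exists k, f i < k.
    have [d fd /seg_surj[k kd]] := infinite_cardinal_limit ck k_inf (seg_lt (f i)).
    by exists k; rewrite -(leW_mono (@seg_mono _)) kd.
  exists g => //; rewrite /dominates (_ : [set _ | _] = set0).
    rewrite cardinal_gt //; apply/negP => /card_le0P mu0.
    by apply: mu_inf; rewrite mu0.
  by apply/seteqP; split=> // i /=; rewrite leNgt fg.
by exists D.
Qed.

Theorem theorem1 (mu kappa : ord)
  (mu_singular : singular_cardinal mu)
  (cf_mu : cofinality mu = kappa)
  (pow2_kappa : pow2 kappa < card_succ_iter mu (card_succ kappa))
  (cf_small : forall alpha : ord, alpha < mu -> cf_subsets alpha kappa < mu)
  (pow2_kappa_nu : exists nu : ord,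
     [/\ is_cardinal nu, nu < mu & pow2 kappa < pow2 nu]) :
  pow2_lt mu <= dominating_number mu kappa.
Proof.
have [cmu mu_inf k_mu] := mu_singular; rewrite cf_mu in k_mu.
have ck : is_cardinal kappa by rewrite -cf_mu; exact: cofinality_cardinal.
have k_inf : infinite_set [set: kappa] by rewrite -cf_mu; exact: infinite_cofinality.
have [D [Ddom <-]] := dominating_numberP cmu mu_inf ck k_inf.
apply: ord_least_le => _ [nu1 [cnu1 nu1_mu] <-]; rewrite leNgt; apply/negP => D_nu1.
have {nu1 cnu1 nu1_mu D_nu1 pow2_kappa_nu} [nu [nu_mu k_nu D_nu]] : exists nu : ord,
    [/\ nu < mu, pow2 kappa < pow2 nu & ord_card D < pow2 nu].
  have [k_nu1|nu1_k] := ltP (pow2 kappa) (pow2 nu1); first by exists nu1.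
  have [nu [_ nu_mu k_nu]] := pow2_kappa_nu; exists nu; split=> //.
  exact/(lt_trans D_nu1)/(le_lt_trans nu1_k).
have [n0 _] : exists n : nu, True.
  apply: contrapT => none; move: k_nu; apply/negP; rewrite -leNgt ord_card_le.
  apply: (@card_le_inj _ _ _ _ (fun _ _ => true)) => // X X' _ _ _.
  by apply/funext => n; case: none; exists n.
pose tau : ord := Order.max (ord_card D) (pow2 kappa).
have D_tau : ord_card D <= tau by rewrite le_max lexx.
have kk_tau : pow2 kappa <= tau by rewrite le_max lexx orbT.
have k_tau : kappa <= tau by exact: le_trans (ltW (lt_pow2 _)) kk_tau.
have tau_inf : infinite_set [set: tau].
  by move=> /(card_le_finite (ord_le_card k_tau)).
have tau_nu : tau < pow2 nu by rewrite gt_max D_nu.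
have nu_lt : ord_card [set: nu] < mu.
  by apply: le_lt_trans nu_mu; rewrite ord_card_le_ord.
have [C [Cmu Ck Ccov]] := cover_family cmu mu_inf ck k_inf cf_small nu_lt.
have {}Ccov : covering kappa C by move=> e; exact: Ccov.
pose catches B (X : nu -> bool) := covering kappa [set Y | C Y /\ B (trace X Y)].
have [B Bmu Bpop] : exists2 B, ord_card B < mu &
    tau < ord_card [set X | catches B X].
  pose S := [set p : (nu -> Prop) * (nu -> Prop) | C p.1 /\ p.2 `<=` p.1].
  have Spop : tau < ord_card [set X | catches S X].
    rewrite (_ : [set _ | _] = setT) //; apply/seteqP; split=> // X _ e.
    have [Y CY Ye] := Ccov e; exists Y => //; split=> //.
    by split=> // n [].
  pose a : ord := Order.max (ord_card C) (pow2 kappa).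
  have k_a : kappa <= a by rewrite le_max (ltW (lt_pow2 _)) orbT.
  have a_inf : infinite_set [set: a] by move=> /(card_le_finite (ord_le_card k_a)).
  have Sa : S #<= [set: a].
    apply: card_traces Ck => //; last by rewrite le_max lexx orbT.
    by rewrite -ord_card_le_ord le_max lexx.
  have [a_mu|mu_a] := ltP a mu.
    by exists S => //; apply: le_lt_trans a_mu; rewrite ord_card_le_ord.
  have mu_kk : mu <= pow2 kappa by move: mu_a; rewrite le_max leNgt Cmu.
  have aE : a = pow2 kappa by apply/max_r/ltW/(lt_le_trans Cmu).
  have [|[eta eta_k kk_eta]] := lt_card_succ_iter pow2_kappa; first by rewrite ltNge mu_kk.
  apply: (@descent mu kappa tau _ _ _ _ _ _ _ catches _ _ eta S) => //.
  - move=> I J F G X Jk GF; apply: (@covering_split kappa nu n0 I J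
        (fun i => [set Y | C Y /\ F i (trace X Y)])) => //.
    by move=> Y [CY /GF[i Ji FY]]; exists i.
  - move=> G X XG; exists [set trace X Y | Y in [set Y | C Y /\ G (trace X Y)]].
    split; first by move=> _ [Y [_ GY] <-].
      apply: le_lt_trans Cmu; rewrite ord_card_le.
      by apply: card_le_trans (card_image_le _ _) _; apply: subset_card_le => Y [].
    move=> G' GG' e; have [Y [CY GY] Ye] := XG e; exists Y => //; split=> //.
    by apply: GG'; exists Y.
  - apply: card_le_trans Sa _; rewrite aE; apply: ord_le_card.
    by have := card_lt_succ kk_eta; rewrite (ord_card_cardinal [set: kappa -> bool]).
  - by apply: le_trans kk_tau; rewrite -aE ord_card_le_ord.
have [f fP] := unbounded_family n0 cmu mu_inf ck k_inf cf_small Cmu Ck Ccov Bmu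
  (fun X (FX : [set X | catches B X] X) => FX).
have [||g Dg gpop] := @pigeonhole_gt _ _ D
    (fun g => [set X | catches B X /\ dominates g (f X)]) _ _ tau_inf _ _ Bpop.
- by rewrite -ord_card_le_ord.
- by move=> X BX; have [g Dg gX] := Ddom (f X); exists g.
(* E supplies kappa bounds for the sizes of the exceptional sets *)
have [E [Ecof EE]] := cofinalityP mu.
pose exc X := [set i | g i <= f X i].
have [||c Ec cpop] := @pigeonhole_gt _ _ E
    (fun c => [set X | catches B X /\ exc X #<= [set: seg c]]) _ _ tau_inf _ _ gpop.
- by rewrite -ord_card_le_ord EE cf_mu.
- move=> X [BX /seg_surj[x xE]]; have [c Ec xc] := Ecof x; exists c => //; split=> //.
  by rewrite -ord_card_le_ord -xE seg_mono.
have : [set: kappa] #<= [set X | catches B X /\ exc X #<= [set: seg c]].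
  by rewrite -cardinal_le //; exact/ltW/(le_lt_trans k_tau).
move=> /(card_le_fun (fun=> true))[X [XB XI]].
have [||M ME MI] := fP X; first by move=> k k'; exact: XI.
  by move=> k; have [] := XB k I.
have [m Mm mX] : exists2 m, M m & forall k, f (X k) m < g m.
  apply: contrapT => none.
  pose b : ord := Order.max kappa (seg c).
  have b_inf : infinite_set [set: b].
    by apply: contra_not k_inf; apply/card_le_finite/ord_le_card; rewrite le_max lexx.
  have b_mu : b < mu by rewrite gt_max k_mu seg_lt.
  have : ord_card M <= b; last by rewrite ME leNgt b_mu.
  rewrite ord_card_le_ord.
  apply: (@card_union_le _ _ [set: kappa] (fun k => exc (X k))) => //.
  - by apply: ord_le_card; rewrite le_max lexx.
  - move=> k _; have [_ /card_le_trans] := XB k I; apply.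
    by apply: ord_le_card; rewrite le_max lexx orbT.
  move=> m Mm; apply: contrapT => nm; apply: none; exists m => // k.
  by rewrite ltNge; apply/negP => mk; apply: nm; exists k.
apply: (cardinal_lt_not_le ck (seg_lt (g m))).
apply: (@card_rank_le _ _ _ (fun k => seg (f (X k) m))) => [k _|k k' _ _ /seg_inj].
  by rewrite (leW_mono (@seg_mono _)).
exact: MI.
Qed.
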